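(* Let $G$ be a finite group and $Y\subset G$ a non-empty subset. Let $D(Y):=\max_{\rho\in\widehat{G}\setminus\{1_G\}}\frac{\partial_\rho(Y)}{\dim\rho}$. Then $$D(Y)\ge\sqrt{\frac{1/\#Y-1/\#G}{\#G-1}},$$ and equality holds if and only if $$\frac{\partial_\rho(Y)}{\dim\rho}=\sqrt{\frac{1/\#Y-1/\#G}{\#G-1}}$$ for every $\rho\in\widehat{G}$ with $\rho\ne 1_G$.
   Context: $\widehat{G}$ is the set of isomorphism classes of irreducible complex representations of $G$; $\chi_\rho$ and $\dim\rho$ denote the character and dimension of $\rho\in\widehat G$; $1_G$ is the trivial representation. For $\rho\in\widehat{G}$, $$\partial_\rho(Y):=\sqrt{\frac{\dim\rho}{(\#Y)^2\,\#G}\sum_{x,y\in Y}\chi_\rho(x^{-1}y)},$$ where the quantity under the square root is a non-negative real number. *)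

(* Defs.v *)
(* Mathematical Components (character theory over algC). *)
From HB Require Import structures.
From mathcomp Require Import all_boot all_order all_algebra all_fingroup.
From mathcomp Require Import all_solvable all_field all_character.

Set Implicit Arguments.
Unset Strict Implicit.
Unset Printing Implicit Defensive.

Import Order.TTheory GRing.Theory Num.Theory.
Local Open Scope ring_scope.

(* The isomorphism classes of irreducible complex representations of G are    *)
(* indexed by Iirr G: the class i contains 'Chi_i, which affords 'chi[G]_i    *)
(* (lemma irrRepr), and index 0 is the trivial representation (lemma irr0).   *)
Definition irr_dim (gT : finGroupType) (G : {group gT}) (i : Iirr G) : nat :=
  irr_degree (socle_of_Iirr i).

Definition partial_rho (gT : finGroupType) (G : {group gT}) (i : Iirr G)
    (Y : {set gT}) : algC :=
  sqrtC ((irr_dim i)%:R / (#|Y|%:R ^+ 2 * #|G|%:R)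
         * \sum_(x in Y) \sum_(y in Y) 'chi[G]_i (x^-1 * y)%g).

(* Each partial_rho i Y is the square root of a nonnegative real, so all the  *)
(* values compared are nonnegative reals: the partiality of the order on algC *)
(* plays no role, and the default value 0 matters only when G is trivial.     *)
Definition maxD (gT : finGroupType) (G : {group gT}) (Y : {set gT}) : algC :=
  \big[Num.max/0]_(i : Iirr G | i != 0) (partial_rho i Y / (irr_dim i)%:R).

(* Main.v *)
Require Import Defs.
From HB Require Import structures.
From mathcomp Require Import all_boot all_order all_algebra all_fingroup.
From mathcomp Require Import all_solvable all_field all_character.
From mathcomp Require Import ring.

Set Implicit Arguments.
Unset Strict Implicit.
Unset Printing Implicit Defensive.

Import Order.TTheory GRing.Theory Num.Theory.
Local Open Scope ring_scope.

(** Put w_rho = (dim rho)^2 and a_rho = (partial_rho(Y) / dim rho)^2. Evaluating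
    the regular character on the products x^-1 y gives
    sum_rho w_rho a_rho = 1/#Y; the trivial representation contributes
    w_1 = 1 and a_1 = 1/#G. Since sum_rho w_rho = #G, the weighted mean of a_rho
    over the nontrivial rho is exactly the square of the announced bound
    ([sum_sqr_irr_discrepancy], [sum_sqr_irr_dim]). A maximum dominates a
    weighted mean, and the two agree only when all the values do
    ([weighted_mean_extremal]).

    When G is trivial there is no such rho, and D(Y) and the bound are both 0.

    For the values partial_rho(Y) / dim rho to be comparable, the quantities
    under the square roots must be nonnegative. This comes from the fact that
    characters are idempotent up to scale for convolution, which turns the
    double sum over Y into a sum of squared moduli over G ([char_sum_ge0]). *)

(** * Maxima and weighted means *)

(** The order of a [numDomainType] is partial, so a maximum is an upper bound
    only of pairwise comparable values; nonnegativity ensures this. *)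
Lemma le_bigmax_nneg (R : numDomainType) (I : finType) (P : pred I)
    (F : I -> R) (i : I) :
  (forall j, P j -> 0 <= F j) -> P i -> F i <= \big[Num.max/0]_(j | P j) F j.
Proof.
move=> F_ge0 Pi; have := mem_index_enum i.
elim: (index_enum I) => // j r IHr.
have F_real k : P k -> F k \is Num.real by move/F_ge0/ger0_real.
have bigmax_real : \big[Num.max/0]_(k <- r | P k) F k \is Num.real.
  by apply: (big_ind (fun x => x \is Num.real)) => // *; apply: max_real.
rewrite inE big_cons => /predU1P[<-|/IHr le_i]; first rewrite Pi.
  rewrite comparable_le_max ?lexx //.
  by apply: real_comparable; rewrite ?F_real.
case: ifPn => // Pj; rewrite comparable_le_max ?le_i ?orbT //.
by apply: real_comparable; rewrite ?F_real.
Qed.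

Lemma bigmax_nneg_ge0 (R : numDomainType) (I : finType) (P : pred I)
    (F : I -> R) :
  (forall j, P j -> 0 <= F j) -> 0 <= \big[Num.max/0]_(j | P j) F j.
Proof.
move=> F_ge0; apply: (big_ind (fun x => 0 <= x)) => // x y x_ge0 y_ge0.
by rewrite /Num.max; case: ifP.
Qed.

Lemma bigmax_le_nneg (R : numDomainType) (I : finType) (P : pred I)
    (F : I -> R) (c : R) :
  0 <= c -> (forall j, P j -> F j <= c) -> \big[Num.max/0]_(j | P j) F j <= c.
Proof.
move=> c_ge0 le_c; apply: (big_ind (fun x => x <= c)) => // x y le_x le_y.
by rewrite /Num.max; case: ifP.
Qed.

(** The gaps m - a i are nonnegative and their weighted sum vanishes. *)
Lemma weighted_mean_extremal (R : numDomainType) (I : finType) (P : pred I)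
    (w a : I -> R) (m : R) :
    (forall i, P i -> 0 < w i) ->
    \sum_(i | P i) w i * a i = (\sum_(i | P i) w i) * m ->
    (forall i, P i -> a i <= m) ->
  forall i, P i -> a i = m.
Proof.
move=> w_gt0 mean_m le_m i Pi.
have gap0 : \sum_(j | P j) w j * (m - a j) = 0.
  under eq_bigr do rewrite mulrBr.
  by rewrite sumrB mean_m mulr_suml subrr.
have gap_ge0 j : P j -> 0 <= w j * (m - a j).
  by move=> Pj; rewrite mulr_ge0 ?subr_ge0 ?le_m // ltW ?w_gt0.
have /eqP := psumr_eq0P gap_ge0 gap0 Pi.
by rewrite mulf_eq0 gt_eqF ?w_gt0 //= subr_eq0 => /eqP.
Qed.

(** * Character sums over a subset of a group *)

Section CharacterSums.

Variables (gT : finGroupType) (G : {group gT}).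
Implicit Types (i : Iirr G) (Y : {set gT}).

Lemma irr_dimE i : (irr_dim i)%:R = 'chi[G]_i 1%g.
Proof. by rewrite /irr_dim irr1_degree. Qed.

Lemma irr_dim_gt0 i : 0 < (irr_dim i)%:R :> algC.
Proof. by rewrite irr_dimE irr1_gt0. Qed.

(** Generalized orthogonality says that 'chi_i is, up to the factor
    dim/#G, its own convolution square; reindexing by g |-> g^-1 x makes the
    two arguments x and y play conjugate roles. *)
Lemma irr_convolution i x y : x \in G ->
  'chi[G]_i (x^-1 * y)%g
  = 'chi_i 1%g / #|G|%:R
    * \sum_(g in G) 'chi_i (g^-1 * y)%g * ('chi_i (g^-1 * x)%g)^*.
Proof.
move=> Gx; have := generalized_orthogonality_relation (x^-1 * y)%g i i.
rewrite eqxx mul1r => orth.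
rewrite -mulrA -[LHS](divfK (irr1_neq0 i)) -orth [RHS]mulrC.
congr (_ * _ * _).
rewrite (reindex_inj invg_inj) (reindex_inj (mulgI x^-1)%g) /=.
apply: eq_big => [g|g _]; first by rewrite groupV groupMl ?groupV.
by rewrite invMg invgK mulgA mulgK irr_inv.
Qed.

(** The convolution identity factors the double sum as
    dim/#G * sum_g |sum_(x in Y) chi(g^-1 x)|^2. *)
Lemma char_sum_ge0 i Y : Y \subset G ->
  0 <= \sum_(x in Y) \sum_(y in Y) 'chi[G]_i (x^-1 * y)%g.
Proof.
move=> sYG.
have ->: \sum_(x in Y) \sum_(y in Y) 'chi[G]_i (x^-1 * y)%g
  = 'chi_i 1%g / #|G|%:R
    * \sum_(g in G) `|\sum_(x in Y) 'chi_i (g^-1 * x)%g| ^+ 2.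
  under eq_bigr => x Yx do under eq_bigr do
    rewrite (irr_convolution i _ (subsetP sYG x Yx)).
  under eq_bigr do rewrite -mulr_sumr exchange_big /=.
  rewrite -mulr_sumr exchange_big /=; congr (_ * _); apply: eq_bigr => g _.
  rewrite normCK rmorph_sum mulr_sumr; apply: eq_bigr => x _.
  by rewrite mulr_suml.
by rewrite mulr_ge0 ?divr_ge0 ?ler0n ?(ltW (irr1_gt0 i)) ?sumr_ge0 // => g _;
   rewrite exprn_ge0.
Qed.

(** The left side is the value at z of the regular character. *)
Lemma sum_irr_dim_char z :
  \sum_(i : Iirr G) (irr_dim i)%:R * 'chi[G]_i z = #|G|%:R *+ (z == 1%g).
Proof.
rewrite -cfRegE cfReg_sum sum_cfunE; apply: eq_bigr => i _.
by rewrite cfunE irr_dimE.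
Qed.

Lemma sum_sqr_irr_dim :
  \sum_(i : Iirr G | i != 0) (irr_dim i)%:R ^+ 2 = #|G|%:R - 1 :> algC.
Proof.
have := sum_irr_dim_char 1%g.
rewrite eqxx (bigD1 0) //= irr_dimE irr0 cfun11 mulr1.
move=> /(canRL (addKr _)); rewrite addrC => <-.
by apply: eq_bigr => i _; rewrite -irr_dimE.
Qed.

(** Only the diagonal x = y survives, by the vanishing of the regular character
    off the identity. *)
Lemma sum_irr_char_sum Y :
  \sum_(i : Iirr G)
     (irr_dim i)%:R * \sum_(x in Y) \sum_(y in Y) 'chi[G]_i (x^-1 * y)%g
  = #|G|%:R * #|Y|%:R.
Proof.
under eq_bigr do rewrite mulr_sumr.
rewrite exchange_big mulr_natr -sumr_const; apply: eq_bigr => x Yx.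
under eq_bigr do rewrite mulr_sumr.
rewrite exchange_big /=; under eq_bigr do rewrite sum_irr_dim_char -eq_mulVg1.
rewrite (bigD1 x) //= eqxx big1 ?addr0 // => y /andP[_ y'x].
by rewrite eq_sym (negPf y'x).
Qed.

Definition irr_discrepancy i Y : algC := partial_rho i Y / (irr_dim i)%:R.

Lemma irr_discrepancy_ge0 i Y : Y \subset G -> 0 <= irr_discrepancy i Y.
Proof.
move=> sYG; rewrite divr_ge0 ?ler0n // sqrtC_ge0.
by rewrite mulr_ge0 ?char_sum_ge0 // divr_ge0 ?mulr_ge0 ?exprn_ge0 ?ler0n.
Qed.

Lemma sqr_irr_discrepancy i Y :
  (irr_dim i)%:R ^+ 2 * irr_discrepancy i Y ^+ 2
  = (#|Y|%:R ^+ 2 * #|G|%:R)^-1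
    * ((irr_dim i)%:R * \sum_(x in Y) \sum_(y in Y) 'chi[G]_i (x^-1 * y)%g).
Proof.
rewrite -exprMn mulrC divfK ?gt_eqF ?irr_dim_gt0 // sqrtCK.
by rewrite mulrAC mulrC.
Qed.

(** Over all irreducible representations the sum is 1/#Y; the term 1/#G
    subtracted is that of the trivial one, whose double sum over Y is
    (#Y)^2. *)
Lemma sum_sqr_irr_discrepancy Y : Y \subset G -> Y != set0 ->
  \sum_(i : Iirr G | i != 0) (irr_dim i)%:R ^+ 2 * irr_discrepancy i Y ^+ 2
  = 1 / #|Y|%:R - 1 / #|G|%:R.
Proof.
move=> sYG Y_neq0.
have nzY : #|Y|%:R != 0 :> algC by rewrite pnatr_eq0 cards_eq0.
have nzG : #|G|%:R != 0 :> algC by rewrite neq0CG.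
under eq_bigr do rewrite sqr_irr_discrepancy.
rewrite -mulr_sumr.
have := sum_irr_char_sum Y; rewrite (bigD1 0) //= => /(canRL (addKr _)) ->.
have ->: \sum_(x in Y) \sum_(y in Y) 'chi[G]_0 (x^-1 * y)%g = #|Y|%:R ^+ 2.
  rewrite expr2 mulr_natl -sumr_const; apply: eq_bigr => x Yx.
  rewrite -sumr_const; apply: eq_bigr => y Yy.
  by rewrite irr0 cfun1E groupM ?groupV ?(subsetP sYG).
rewrite irr_dimE irr0 cfun11.
by field; rewrite nzY nzG.
Qed.

End CharacterSums.

Theorem proposition1p1 (gT : finGroupType) (G : {group gT}) (Y : {set gT})
    (sYG : Y \subset G) (Y_neq0 : Y != set0) :
  sqrtC ((1 / #|Y|%:R - 1 / #|G|%:R) / (#|G|%:R - 1)) <= maxD G Y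
  /\ (maxD G Y = sqrtC ((1 / #|Y|%:R - 1 / #|G|%:R) / (#|G|%:R - 1))
      <-> (forall i : Iirr G, i != 0 ->
             partial_rho i Y / (irr_dim i)%:R
             = sqrtC ((1 / #|Y|%:R - 1 / #|G|%:R) / (#|G|%:R - 1)))).
Proof.
have v_ge0 (i : Iirr G) : 0 <= irr_discrepancy i Y.
  exact: irr_discrepancy_ge0.
have le_max (i : Iirr G) : i != 0 -> irr_discrepancy i Y <= maxD G Y.
  by apply: (le_bigmax_nneg (F := fun j => irr_discrepancy j Y)) => j _.
have max_ge0 : 0 <= maxD G Y by apply: bigmax_nneg_ge0 => j _; apply: v_ge0.
set c := sqrtC _.
have G1_ge0 : 0 <= #|G|%:R - 1 :> algC by rewrite subr_ge0 ler1n cardG_gt0.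
have c_ge0 : 0 <= c.
  rewrite sqrtC_ge0 divr_ge0 // -(sum_sqr_irr_discrepancy sYG Y_neq0).
  by rewrite sumr_ge0 // => i _; rewrite mulr_ge0 // exprn_ge0 ?ler0n.
have mean_c : \sum_(i : Iirr G | i != 0)
    (irr_dim i)%:R ^+ 2 * irr_discrepancy i Y ^+ 2
  = (\sum_(i : Iirr G | i != 0) (irr_dim i)%:R ^+ 2) * c ^+ 2.
  rewrite sum_sqr_irr_discrepancy // sum_sqr_irr_dim sqrtCK [RHS]mulrC.
  have [G1_0|nzG1] := eqVneq (#|G|%:R - 1 : algC) 0; last by rewrite divfK.
  (* In the trivial group Y = G, so that both sides vanish. *)
  have G1 : #|G| = 1%N by apply/eqP; rewrite -(eqr_nat algC) -subr_eq0 G1_0.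
  have Y1 : #|Y| = 1%N.
    by apply/eqP; rewrite eqn_leq card_gt0 Y_neq0 -G1 subset_leq_card.
  by rewrite G1 Y1 subrr !mul0r.
have le_c_max : c <= maxD G Y.
  have [G1_0|nzG1] := eqVneq (#|G|%:R - 1 : algC) 0.
    (* Division by zero yields zero, so the bound is 0 in the trivial group. *)
    by rewrite /c G1_0 invr0 mulr0 sqrtC0.
  have G1_gt0 : 0 < #|G|%:R - 1 :> algC by rewrite lt_def nzG1.
  rewrite -(ler_pXn2r (n := 2)) ?nnegrE // -(ler_pM2l G1_gt0).
  rewrite -sum_sqr_irr_dim -mean_c mulr_suml; apply: ler_sum => i nz_i.
  by rewrite ler_wpM2l ?exprn_ge0 ?ler0n // lerXn2r ?nnegrE ?le_max.
split=> //; split=> [max_c | v_c]; last first.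
  apply/le_anti; rewrite le_c_max andbT.
  by apply: bigmax_le_nneg => // i nz_i; rewrite v_c.
have le_c (i : Iirr G) : i != 0 -> irr_discrepancy i Y ^+ 2 <= c ^+ 2.
  move=> nz_i; have := le_max i nz_i; rewrite max_c => le_ci.
  by rewrite lerXn2r ?nnegrE.
have w_gt0 (i : Iirr G) : i != 0 -> 0 < (irr_dim i)%:R ^+ 2 :> algC.
  by rewrite exprn_gt0 ?irr_dim_gt0.
move=> i nz_i; have := weighted_mean_extremal w_gt0 mean_c le_c nz_i.
by move/eqP; rewrite eqrXn2 // => /eqP.
Qed.
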